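(* Every satisfiable \mbox{UNFO}$^2${+}\mbox{EQ} formula $\phi$ has a finite model whose size is bounded doubly exponentially in $|\phi|$.
   Context: Signatures are purely relational, $\sigma=\sigma_{base}\cup\sigma_{dist}$, with all symbols of $\sigma_{dist}$ binary. \mbox{UNFO} (unary negation fragment of first-order logic) is given by the grammar $\phi ::= R(\bar x)\mid x=y\mid \phi\wedge\phi\mid\phi\vee\phi\mid\exists x\,\phi\mid\neg\phi(x)$, where in the last clause $\phi$ has no free variables besides (at most) $x$. \mbox{UNFO}{+}\mbox{EQ} has the same syntax, but admissible models (for satisfiability) must interpret every symbol of $\sigma_{dist}$ as an equivalence relation. \mbox{UNFO}$^2${+}\mbox{EQ} is the restriction of \mbox{UNFO}{+}\mbox{EQ} to formulas using only two variables. *)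

(* Defs.v *)
From mathcomp Require Import all_boot.
From Stdlib Require Import RelationClasses.

Set Implicit Arguments.
Unset Strict Implicit.
Unset Printing Implicit Defensive.

(* The distinguished symbols are binary, so only base symbols carry an arity. *)
Record signature := Signature {
  base : Type;
  dist : Type;
  arity : base -> nat
}.

Inductive formula (sigma : signature) : Type :=
  | Base (R : base sigma) of (arity R).-tuple nat
  | Dist of dist sigma & nat & nat
  | Eq of nat & nat
  | And of formula sigma & formula sigma
  | Or of formula sigma & formula sigma
  | Exists of nat & formula sigma
  | Not of formula sigma.

Section Syntax.
Variable sigma : signature.
Implicit Types phi psi : formula sigma.

Fixpoint free_vars phi : seq nat :=
  match phi with
  | Base _ xs => xs
  | Dist _ x y | Eq x y => [:: x; y]
  | And phi1 phi2 | Or phi1 phi2 => free_vars phi1 ++ free_vars phi2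
  | Exists x psi => [seq y <- free_vars psi | y != x]
  | Not psi => free_vars psi
  end.

(* All variables, free, bound or merely quantified. *)
Fixpoint vars phi : seq nat :=
  match phi with
  | Base _ xs => xs
  | Dist _ x y | Eq x y => [:: x; y]
  | And phi1 phi2 | Or phi1 phi2 => vars phi1 ++ vars phi2
  | Exists x psi => x :: vars psi
  | Not psi => vars psi
  end.

(* The number of occurrences of symbols (relation symbols, equality,
   connectives, quantifiers, variables), parentheses not counted. *)
Fixpoint length phi : nat :=
  match phi with
  | Base R _ => (arity R).+1
  | Dist _ _ _ | Eq _ _ => 3
  | And phi1 phi2 | Or phi1 phi2 => (length phi1 + length phi2).+1
  | Exists _ psi => (length psi).+2
  | Not psi => (length psi).+1
  end.

Fixpoint unfo phi : bool :=
  match phi with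
  | Base _ _ | Dist _ _ _ | Eq _ _ => true
  | And phi1 phi2 | Or phi1 phi2 => unfo phi1 && unfo phi2
  | Exists _ psi => unfo psi
  | Not psi => unfo psi && (size (undup (free_vars psi)) <= 1)
  end.

(* The two variables may be requantified arbitrarily often. *)
Definition unfo2 phi : bool := unfo phi && (size (undup (vars phi)) <= 2).

End Syntax.

Record structure (sigma : signature) (D : Type) := Structure {
  base_interp : forall R : base sigma, (arity R).-tuple D -> Prop;
  dist_interp : dist sigma -> D -> D -> Prop
}.

Section Semantics.
Variables (sigma : signature) (D : Type) (M : structure sigma D).

Definition admissible : Prop :=
  forall E : dist sigma, Equivalence (dist_interp M E).

Fixpoint holds (v : nat -> D) (phi : formula sigma) : Prop :=
  match phi with
  | Base R xs => base_interp M (map_tuple v xs)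
  | Dist E x y => dist_interp M E (v x) (v y)
  | Eq x y => v x = v y
  | And phi1 phi2 => holds v phi1 /\ holds v phi2
  | Or phi1 phi2 => holds v phi1 \/ holds v phi2
  | Exists x psi => exists a : D, holds [eta v with x |-> a] psi
  | Not psi => ~ holds v psi
  end.

(* The assignment matters only when phi has free variables; its existence
   also forces the domain to be nonempty. *)
Definition is_model (phi : formula sigma) : Prop :=
  admissible /\ exists v : nat -> D, holds v phi.

End Semantics.

Definition satisfiable (sigma : signature) (phi : formula sigma) : Prop :=
  exists (D : Type) (M : structure sigma D), is_model M phi.

(* Main.v *)
Require Import Defs.
From mathcomp Require Import all_boot.
From mathcomp Require Import boolp.
From mathcomp Require Import zify.
From Stdlib Require List.

(* The 1-type of a is the set of subformulas true when all variables have the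
   value a. A finite structure with a 1-type assigned to each element satisfies
   phi (closed by quantifying its two variables) as soon as every pair of its
   elements maps homomorphically, preserving 1-types, to a pair of the
   given model M, and every element has copies of the witnesses its 1-type asks
   for. The difficulty is that elements equivalent in the finite structure for
   every i in T must come from elements of M lying in one class of the
   intersection of the E_i, i in T. So each element stores, for each nonempty T,
   the set of 1-types realized in its T-class in M, split as a sum over F_2 of
   one summand for each i in T; being i-equivalent means sharing the i-th
   summands for all T containing i. Elements i-equivalent for all i in T then
   share the sum for T. A witness inequivalent for some j in T may have any sum
   for T, since its j-th summand is free to change. Only exponentially many bits
   are stored. *)

Set Implicit Arguments.
Unset Strict Implicit.
Unset Printing Implicit Defensive.

(** * Subformulas and variables *)

Section Formulas.
Variable sigma : signature.
Implicit Types phi psi : formula sigma.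

Fixpoint subformulas phi : seq (formula sigma) :=
  phi :: match phi with
         | And phi1 phi2 | Or phi1 phi2 => subformulas phi1 ++ subformulas phi2
         | Exists _ psi | Not psi => subformulas psi
         | _ => [::]
         end.

Lemma subformulas_refl phi : List.In phi (subformulas phi).
Proof. by case: phi => *; left. Qed.

Lemma size_subformulas phi : size (subformulas phi) <= length phi.
Proof.
elim: phi => //= [phi1 IH1 phi2 IH2|phi1 IH1 phi2 IH2|x psi IH].
- by rewrite size_cat ltnS leq_add.
- by rewrite size_cat ltnS leq_add.
- by rewrite ltnS leqW.
Qed.

Lemma free_vars_sub phi : {subset free_vars phi <= vars phi}.
Proof.
elim: phi => [R xs|E x y|x y|phi1 IH1 phi2 IH2|phi1 IH1 phi2 IH2|x psi IH
  |psi IH] //= z.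
- by rewrite !mem_cat => /orP[/IH1|/IH2] ->; rewrite ?orbT.
- by rewrite !mem_cat => /orP[/IH1|/IH2] ->; rewrite ?orbT.
- by rewrite mem_filter inE => /andP[_ /IH ->]; rewrite orbT.
Qed.

Lemma holds_ext (D : Type) (M : structure sigma D) phi (v v' : nat -> D) :
  {in free_vars phi, v =1 v'} -> holds M v phi -> holds M v' phi.
Proof.
elim: phi v v' => /= [R xs|E x y|x y|phi1 IH1 phi2 IH2|phi1 IH1 phi2 IH2
  |x psi IH|psi IH] v v' vv'.
- suff -> : map_tuple v xs = map_tuple v' xs by [].
  by apply: val_inj => /=; apply/eq_in_map.
- by rewrite !vv' ?inE ?eqxx ?orbT.
- by rewrite !vv' ?inE ?eqxx ?orbT.
- move=> [h1 h2]; split; [apply: IH1 h1|apply: IH2 h2] => z zP;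
    by apply: vv'; rewrite mem_cat zP ?orbT.
- move=> [h|h]; [left; apply: IH1 h|right; apply: IH2 h] => z zP;
    by apply: vv'; rewrite mem_cat zP ?orbT.
- move=> [a h]; exists a; apply: IH h => z zP /=.
  by case: eqP => // /eqP zx; apply: vv'; rewrite mem_filter zx.
- by move=> nh h; apply: nh; apply: IH h => z /vv'.
Qed.

End Formulas.

(** Formulas over arbitrary symbol types have no decidable equality, so subformulas are handled by
    their positions. *)
Lemma In_tnth (T : Type) (x : T) (s : seq T) :
  List.In x s -> exists i, tnth (in_tuple s) i = x.
Proof.
move=> xs; suff [i ltis ix] : exists2 i, i < size s & nth x s i = x.
  by exists (Ordinal ltis); rewrite (tnth_nth x).
elim: s xs => //= y s IH [->|/IH [i ltis ix]]; first by exists 0.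
by exists i.+1.
Qed.

Lemma size_undup_le1 (s : seq nat) :
  size (undup s) <= 1 -> exists x, {in s, forall y, y = x}.
Proof.
case us: (undup s) => [|x [|]] // _; [exists 0|exists x] => y;
  by rewrite -mem_undup us // inE => /eqP.
Qed.

Lemma size_undup_le2 (s : seq nat) :
  size (undup s) <= 2 -> exists x y, {subset s <= [:: x; y]}.
Proof.
case us: (undup s) => [|x [|y [|]]] // _; [exists 0, 0|exists x, x|exists x, y];
  by move=> z; rewrite -mem_undup us // !inE => ->.
Qed.

Section FiniteModel.
Variables (sigma : signature) (A : Type) (M : structure sigma A).
Hypothesis admM : admissible M.
Variable phi : formula sigma.
Variables p q : nat.
Hypothesis vars_phi : {subset vars phi <= [:: p; q]}.

(** * 1-types and equivalence classes in the given model *)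

Let n := size (subformulas phi).
Let sub (i : 'I_n) : formula sigma := tnth (in_tuple (subformulas phi)) i.

Definition type1 : finType := {ffun 'I_n -> bool}.

Definition ty (a : A) : type1 := [ffun i => `[< holds M (fun=> a) (sub i) >]].

(* Distinguished symbols are indexed by the subformulas in which they occur;
   at other indices eqv is total. *)
Definition eqv (i : 'I_n) (a b : A) : Prop :=
  forall E x y, sub i = Dist E x y -> dist_interp M E a b.

Lemma eqv_refl i a : eqv i a a.
Proof. by move=> E x y _; case: (admM E). Qed.

Lemma eqv_sym i a b : eqv i a b -> eqv i b a.
Proof. by move=> ab E x y si; case: (admM E) => _ + _; apply; apply: ab si. Qed.

Lemma eqv_trans i a b c : eqv i a b -> eqv i b c -> eqv i a c.
Proof.
move=> ab bc E x y si; case: (admM E) => _ _; apply; first exact: ab si.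
exact: bc si.
Qed.

Definition near (T : {set 'I_n}) (a : A) (t : type1) : bool :=
  `[< exists2 b, forall i, i \in T -> eqv i a b & ty b = t >].

Lemma near_eqv (T : {set 'I_n}) a b :
  (forall i, i \in T -> eqv i a b) -> near T a =1 near T b.
Proof.
move=> ab t; apply/asboolP/asboolP => -[c ac ct]; exists c => // i iT.
- exact: eqv_trans (eqv_sym (ab i iT)) (ac i iT).
- exact: eqv_trans (ab i iT) (ac i iT).
Qed.

(** * Splitting sets of 1-types over F_2, and the finite domain *)

Definition weights : finType := {ffun {set 'I_n} * 'I_n * type1 -> bool}.

(** The empty [T] is excluded: its sum is [false], but [near set0 a] holds for every 1-type realized
    in [M]. *)
Definition fits (w : weights) (a : A) : Prop :=
  forall (T : {set 'I_n}) t, T != set0 ->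
    \big[addb/false]_(i in T) w (T, i, t) = near T a t.

(** For each [T] not inside [S], one summand with index outside [S] is corrected. Those with index
    in [S] survive, since [b] must share them with its source. *)
Definition retune (w : weights) (S : {set 'I_n}) (b : A) : weights :=
  [ffun k : {set 'I_n} * 'I_n * type1 => let: (T, i, t) := k in
    if [pick j in T :\: S] == Some i
    then near T b t (+) \big[addb/false]_(j in T | j != i) w (T, j, t)
    else w (T, i, t)].

Lemma retune_in w (S : {set 'I_n}) b T i t : i \in S ->
  retune w S b (T, i, t) = w (T, i, t).
Proof.
move=> iS; rewrite ffunE; case: pickP => [j|//]; rewrite inE.
by case: eqP => // -[->]; rewrite iS.
Qed.

Lemma fits_retune (w : weights) (S : {set 'I_n}) b :
  (forall T : {set 'I_n}, T != set0 -> T \subset S ->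
    forall t, \big[addb/false]_(i in T) w (T, i, t) = near T b t) ->
  fits (retune w S b) b.
Proof.
move=> wS T t T0.
have [TS|TS] := boolP (T \subset S).
  rewrite -(wS T T0 TS t); apply: eq_bigr => i iT.
  by rewrite retune_in // (subsetP TS).
have [j jTS pj] : exists2 j, j \in T :\: S & [pick j in T :\: S] = Some j.
  case: pickP => [j jTS|none]; first by exists j.
  by case/subsetPn: TS => j jT jS; move: (none j); rewrite inE jT jS.
have jT : j \in T by move: jTS; rewrite inE => /andP[].
(* The summand at [j] is the target plus the sum of the others, which cancels over F_2. *)
rewrite (bigD1 j) //= ffunE pj eqxx -addbA [X in _ (+) X]addbC.
rewrite (eq_bigr (fun i => w (T, i, t))) ?addbb ?addbF // => i /andP[_ ij].
by rewrite ffunE pj; case: eqP => // -[ji]; rewrite ji eqxx in ij.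
Qed.

(* The components are the 1-type, the weights, a mark per equivalence that makes
   a witness inequivalent to its source exactly when it is so in M, the subformula
   the element is a witness for, and a phase modulo 3; the last two ensure that
   a pair of elements is never a source and witness in two different ways. *)
Definition pre : finType :=
  (type1 * weights * {ffun 'I_n -> bool} * option 'I_n * 'I_3)%type.

Definition realizes (x : pre) (a : A) : Prop :=
  let: (t, w, _, _, _) := x in ty a = t /\ fits w a.

Definition dom : finType := {x : pre | `[< exists a, realizes x a >]}.

Definition tau (x : dom) : type1 := (val x).1.1.1.1.
Definition wgt (x : dom) : weights := (val x).1.1.1.2.
Definition mark (x : dom) : {ffun 'I_n -> bool} := (val x).1.1.2.
Definition goal (x : dom) : option 'I_n := (val x).1.2.
Definition phase (x : dom) : 'I_3 := (val x).2.

Lemma rep_ex (x : dom) : exists a, ty a = tau x /\ fits (wgt x) a.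
Proof.
case: x => -[[[[t w] m] g] c] /= xP; case/asboolP: (xP) => a [at_ aw].
by exists a.
Qed.

Definition rep (x : dom) : A := projT1 (cid (rep_ex x)).

Lemma ty_rep x : ty (rep x) = tau x.
Proof. by rewrite /rep; case: cid => a []. Qed.

Lemma fits_rep x : fits (wgt x) (rep x).
Proof. by rewrite /rep; case: cid => a []. Qed.

(** * Witnesses and their copies in the finite domain *)

Lemma wit_ex (a : A) (i : 'I_n) : exists b, forall z psi,
  sub i = Exists z psi -> holds M (fun=> a) (sub i) ->
  holds M [eta (fun=> a) with z |-> b] psi.
Proof.
case: (sub i) => [||||| x chi |]; try by exists a.
have [[b hb]|no] := pselect (holds M (fun=> a) (Exists x chi)).
  by exists b => z psi [<- <-].
by exists a => z psi _ /no.
Qed.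

Definition wit (a : A) (oi : option 'I_n) : A :=
  if oi is Some i then projT1 (cid (wit_ex a i)) else a.

Lemma witP a i z psi : sub i = Exists z psi ->
  holds M (fun=> a) (Exists z psi) ->
  holds M [eta (fun=> a) with z |-> wit a (Some i)] psi.
Proof.
move=> si; rewrite -si /wit; case: cid => b bP /=.
exact: bP.
Qed.

Definition dom_eqv (i : 'I_n) (x y : dom) : Prop :=
  mark x i = mark y i /\
  forall (T : {set 'I_n}) t, i \in T -> wgt x (T, i, t) = wgt y (T, i, t).

Definition common (a b : A) : {set 'I_n} := [set i | `[< eqv i a b >]].

(** No copy is made when the witness is the source itself, so that equality is reflected. The
    default of [insubd] is never reached, by [val_step]. *)
Definition step (x : dom) (oi : option 'I_n) : dom :=
  let a := rep x in let b := wit a oi in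
  if `[< b = a >] then x else
  insubd x (ty b, retune (wgt x) (common a b) b,
            [ffun i => mark x i (+) (i \notin common a b)], oi, ordS (phase x)).

Lemma step_id x oi : wit (rep x) oi = rep x -> step x oi = x.
Proof. by move=> e; rewrite /step; case: asboolP. Qed.

Lemma val_step x oi : wit (rep x) oi <> rep x ->
  val (step x oi) = (ty (wit (rep x) oi),
    retune (wgt x) (common (rep x) (wit (rep x) oi)) (wit (rep x) oi),
    [ffun i => mark x i (+) (i \notin common (rep x) (wit (rep x) oi))],
    oi, ordS (phase x)).
Proof.
set a := rep x; set b := wit a oi => ba.
rewrite /step -/a -/b; case: asboolP => // _; rewrite insubdK //.
apply/asboolP; exists b; split=> //; apply: fits_retune => T T0 TS t.
(* For [T] inside [common], source and witness lie in the same [T]-class, so the old sum is already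
   right. *)
rewrite fits_rep //; apply: near_eqv => i iT.
by move/(subsetP TS): iT; rewrite inE => /asboolP.
Qed.

Lemma ordS3_neq (c : 'I_3) : ordS c <> c.
Proof. by case: c => -[|[|[|//]]] ? /(congr1 val). Qed.

(** This is why phases are counted modulo 3: modulo 2, two steps would return. *)
Lemma ordS3_neq2 (c : 'I_3) : ordS (ordS c) <> c.
Proof. by case: c => -[|[|[|//]]] ? /(congr1 val). Qed.

Lemma phase_step x oi : wit (rep x) oi <> rep x ->
  phase (step x oi) = ordS (phase x).
Proof. by move=> /val_step; rewrite /phase => ->. Qed.

Lemma goal_step x oi : wit (rep x) oi <> rep x -> goal (step x oi) = oi.
Proof. by move=> /val_step; rewrite /goal => ->. Qed.

Lemma step_eq x oi : step x oi = x -> wit (rep x) oi = rep x.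
Proof.
move=> sx; apply: contrapT => /phase_step; rewrite sx => /esym.
exact: ordS3_neq.
Qed.

Lemma tau_step x oi : tau (step x oi) = ty (wit (rep x) oi).
Proof.
have [e|ne] := pselect (wit (rep x) oi = rep x).
  by rewrite step_id // e ty_rep.
by rewrite /tau val_step.
Qed.

Lemma dom_eqv_refl i x : dom_eqv i x x.
Proof. by []. Qed.

Lemma dom_eqv_sym i x y : dom_eqv i x y -> dom_eqv i y x.
Proof. by move=> [mxy wxy]; split=> // T t iT; rewrite wxy. Qed.

Lemma dom_eqv_trans i x y z : dom_eqv i x y -> dom_eqv i y z -> dom_eqv i x z.
Proof.
move=> [mxy wxy] [myz wyz]; split=> [|T t iT]; first by rewrite mxy.
by rewrite wxy // wyz.
Qed.

(** For [i] in [common], mark and [i]-th summands are kept; otherwise the flipped mark separates the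
    two. *)
Lemma dom_eqv_step i x oi :
  dom_eqv i x (step x oi) <-> eqv i (rep x) (wit (rep x) oi).
Proof.
have [e|ne] := pselect (wit (rep x) oi = rep x).
  by rewrite step_id // e; split=> _; [apply: eqv_refl|].
rewrite /dom_eqv /mark /wgt val_step //= ffunE inE; case: asboolP => H.
  split=> // _; split=> [|T t iT]; first by rewrite addbF.
  by rewrite retune_in // inE; apply/asboolP.
split=> [[+ _]|/H //]; rewrite /mark; by case: ((val x).1.1.2 i).
Qed.

(** * The finite structure and its source-witness pairs *)

Definition lift (x : dom) (oi : option 'I_n) (z : dom) : A :=
  if z == x then rep x else wit (rep x) oi.

Lemma lift_src x oi : lift x oi x = rep x.
Proof. by rewrite /lift eqxx. Qed.

Lemma lift_step x oi : lift x oi (step x oi) = wit (rep x) oi.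
Proof. by rewrite /lift; case: eqP => // /step_eq. Qed.

(** Base facts are exactly those copied from source-witness pairs. A distinguished symbol that does
    not occur in [phi] becomes the total relation. *)
Definition dom_struct : structure sigma dom := {|
  base_interp := fun R t => exists x oi,
    {subset t <= [:: x; step x oi]} /\
    base_interp M (map_tuple (lift x oi) t);
  dist_interp := fun E x y =>
    forall i, (exists z z', sub i = Dist E z z') -> dom_eqv i x y |}.

Lemma dom_admissible : admissible dom_struct.
Proof.
move=> E; split=> /=.
- by move=> x i _; apply: dom_eqv_refl.
- by move=> x y xy i si; apply/dom_eqv_sym/xy.
- by move=> x y z xy yz i si; apply: dom_eqv_trans (xy i si) (yz i si).
Qed.

(** * Facts decided by 1-types *)

Definition occurs (psi : formula sigma) := List.In psi (subformulas phi).

Lemma occurs_ty psi a b : occurs psi -> ty a = ty b ->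
  holds M (fun=> a) psi -> holds M (fun=> b) psi.
Proof.
move=> psiP ab; have [i <-] := In_tnth psiP => h.
have := congr1 (fun t : type1 => t i) ab; rewrite !ffunE => {}ab.
by apply/asboolP; rewrite -ab; apply/asboolP.
Qed.

(** With at most one free variable the assignment may be made constant, and constant assignments are
    what 1-types record. *)
Lemma occurs_ty_unary psi o (v v' : nat -> A) : occurs psi ->
  {in free_vars psi, forall z, z = o} ->
  {in free_vars psi, forall z, ty (v z) = ty (v' z)} ->
  holds M v psi -> holds M v' psi.
Proof.
move=> psiP fv_o vv' hv.
have h : holds M (fun=> v o) psi by apply: holds_ext hv => z /fv_o ->.
have [oP|oN] := boolP (o \in free_vars psi).
  have {}h := occurs_ty psiP (vv' o oP) h.
  by apply: holds_ext h => z /fv_o ->.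
apply: holds_ext h => z zP.
by move: oN; rewrite -(fv_o z zP) zP.
Qed.

Definition ty_on (X : seq dom) (h : dom -> A) : Prop :=
  {in X, forall x, ty (h x) = tau x}.

Lemma ty_lift x oi : ty_on [:: x; step x oi] (lift x oi).
Proof.
move=> y; rewrite !inE => /orP[] /eqP ->; first by rewrite lift_src ty_rep.
by rewrite lift_step tau_step.
Qed.

(** Under a constant assignment the variables [xs] of the occurrence do not matter, so the 1-type
    decides [R] on constant tuples. *)
Lemma base_const R xs (t : (arity R).-tuple dom) d a :
  occurs (@Base _ R xs) -> base_interp dom_struct t ->
  {in t, forall x, x = d} -> ty a = tau d ->
  base_interp M (map_tuple (fun=> a) t).
Proof.
move=> RP [x [oi [tx Rt]]] td ad.
have -> : map_tuple (fun=> a) t = map_tuple (fun=> a) xs.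
  by apply: eq_from_tnth => i; rewrite !tnth_map.
have {}Rt : base_interp M (map_tuple (fun=> lift x oi d) xs).
  suff <- : map_tuple (lift x oi) t = map_tuple (fun=> lift x oi d) xs by [].
  by apply: eq_from_tnth => i; rewrite !tnth_map (td _ (mem_tnth i t)).
have [dt|dt] := boolP (d \in t).
  by apply: (occurs_ty RP) Rt; rewrite ad ty_lift // tx.
(* Here [R] is nullary: any entry of [t] would be [d]. *)
suff -> : map_tuple (fun=> a) xs = map_tuple (fun=> lift x oi d) xs by [].
apply: eq_from_tnth => i.
by move: dt; rewrite -(td _ (mem_tnth i t)) mem_tnth.
Qed.

(** * Maps of pairs into [M] and transfer of formulas *)

Definition hom (X : seq dom) (h : dom -> A) : Prop :=
  [/\ ty_on X h,
      {in X &, forall x y i, dom_eqv i x y -> eqv i (h x) (h y)} &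
      forall R xs (t : (arity R).-tuple dom), occurs (@Base _ R xs) ->
        {subset t <= X} -> base_interp dom_struct t ->
        base_interp M (map_tuple h t)].

(** While [hom] carries atoms to [M], [back] carries them from [M] to the finite structure. Both
    keep 1-types, through which negations and quantifiers pass. *)
Definition back (X : seq dom) (h : dom -> A) : Prop :=
  [/\ ty_on X h,
      {in X &, injective h},
      {in X &, forall x y i, eqv i (h x) (h y) -> dom_eqv i x y} &
      forall R (t : (arity R).-tuple dom), {subset t <= X} ->
        base_interp M (map_tuple h t) -> base_interp dom_struct t].

Lemma hom_sub (X Y : seq dom) h : {subset Y <= X} -> hom X h -> hom Y h.
Proof.
move=> YX [h1 h2 h3]; split.
- by move=> x /YX; apply: h1.
- by move=> x y /YX xX /YX; apply: h2.
- by move=> R xs t RP tY; apply: (h3 _ xs) => // x /tY /YX.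
Qed.

Lemma back_sub (X Y : seq dom) h : {subset Y <= X} -> back X h -> back Y h.
Proof.
move=> YX [h1 h2 h3 h4]; split.
- by move=> x /YX; apply: h1.
- by move=> x y /YX xX /YX; apply: h2.
- by move=> x y /YX xX /YX; apply: h3.
- by move=> R t tY; apply: h4 => x /tY /YX.
Qed.

Lemma back_lift x oi : back [:: x; step x oi] (lift x oi).
Proof.
split; first exact: ty_lift.
- move=> y z; rewrite !inE => /orP[] /eqP-> /orP[] /eqP-> //;
  by rewrite lift_src lift_step => e; rewrite step_id.
- move=> y z; rewrite !inE => /orP[] /eqP-> /orP[] /eqP-> i //;
    rewrite lift_src lift_step; first by move/dom_eqv_step.
  by move=> /eqv_sym ?; apply/dom_eqv_sym/dom_eqv_step.
- by move=> R t tX Rt; exists x, oi.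
Qed.

(** A fact using only one of [x], [y] is settled by 1-types. One using both was copied from a
    source-witness pair, so it suffices that [h] agrees with the corresponding [lift]. *)
Lemma base_hom x y h R xs (t : (arity R).-tuple dom) : occurs (@Base _ R xs) ->
  ty_on [:: x; y] h ->
  (forall oi, x <> y -> step x oi = y -> {in t, h =1 lift x oi}) ->
  (forall oi, x <> y -> step y oi = x -> {in t, h =1 lift y oi}) ->
  {subset t <= [:: x; y]} -> base_interp dom_struct t ->
  base_interp M (map_tuple h t).
Proof.
move=> RP hty hxy hyx txy Rt.
have Rconst d : d \in [:: x; y] -> {in t, forall z, z = d} ->
    base_interp M (map_tuple h t).
  move=> dxy td; suff -> : map_tuple h t = map_tuple (fun=> h d) t.
    exact: base_const RP Rt td (hty _ dxy).
  by apply: eq_from_tnth => i; rewrite !tnth_map (td _ (mem_tnth i t)).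
have in1 u v : {subset t <= [:: u; v]} -> u \notin t -> {in t, forall z, z = v}.
  move=> tuv ut z zt; have := tuv z zt; rewrite !inE => /orP[]/eqP // zu.
  by move: ut; rewrite -zu zt.
have [xt|xt] := boolP (x \in t); last first.
  by apply: (Rconst y); [rewrite !inE eqxx orbT|apply: in1 xt].
have [yt|yt] := boolP (y \in t); last first.
  apply: (Rconst x); first by rewrite !inE eqxx.
  by apply: in1 yt => z /txy; rewrite !inE orbC.
have [exy|nxy] := eqVneq x y.
  apply: (Rconst x) => [|z /txy]; first by rewrite !inE eqxx.
  by rewrite -exy !inE orbb => /eqP.
move/eqP in nxy; case: Rt => u [oi [tu Ru]].
have lift_eq : {in t, h =1 lift u oi} -> base_interp M (map_tuple h t).
  move=> e; suff -> : map_tuple h t = map_tuple (lift u oi) t by [].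
  by apply: val_inj => /=; apply/eq_in_map.
have := tu x xt; have := tu y yt; rewrite !inE.
move=> /orP[]/eqP yu /orP[]/eqP xu; subst.
- by case: nxy.
- by apply: lift_eq; apply: hyx.
- by apply: lift_eq; apply: hxy.
- by case: nxy.
Qed.

Lemma step_inj x oi oj : step x oi <> x -> step x oi = step x oj -> oi = oj.
Proof.
move=> nx e; have wi : wit (rep x) oi <> rep x by move/step_id.
have wj : wit (rep x) oj <> rep x by move/step_id => e'; apply: nx; rewrite e.
by rewrite -(goal_step wi) e goal_step.
Qed.

Lemma step_asym x oi oj : step x oi <> x -> step (step x oi) oj <> x.
Proof.
move=> nx e; have wi : wit (rep x) oi <> rep x by move/step_id.
have wj : wit (rep (step x oi)) oj <> rep (step x oi).
  by move/step_id => e'; apply: nx; rewrite -e' e.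
have := phase_step wj; rewrite e phase_step // => /esym.
exact: ordS3_neq2.
Qed.

(** The goal determines [oi] and the phase the direction, so no other [lift] contributes facts on
    this pair. *)
Lemma hom_lift x oi : hom [:: x; step x oi] (lift x oi).
Proof.
split; first exact: ty_lift.
- move=> y z; rewrite !inE => /orP[] /eqP-> /orP[] /eqP-> i;
    rewrite ?lift_src ?lift_step ?dom_eqv_step => yz //; try exact: eqv_refl.
  exact/eqv_sym/dom_eqv_step/dom_eqv_sym.
- move=> R xs t RP tX; apply: (base_hom RP (@ty_lift x oi)) => // oj nx e.
    by rewrite (@step_inj x oi oj) // => ?; apply: nx.
  by case: (@step_asym x oi oj) => // ?; apply: nx.
Qed.

Lemma hom_ex x y : exists h, hom [:: x; y] h.
Proof.
have [[oi <-]|nxy] := pselect (exists oi, step x oi = y).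
  by exists (lift x oi); apply: hom_lift.
have [[oi <-]|nyx] := pselect (exists oi, step y oi = x).
  exists (lift y oi); apply: hom_sub (@hom_lift y oi) => z.
  by rewrite !inE orbC.
have xy : y != x.
  by apply/eqP => e; apply: nxy; exists None; rewrite step_id.
pose T := [set i | `[< dom_eqv i x y >]].
have [b xb by_] : exists2 b, forall i, i \in T -> eqv i (rep x) b & ty b = tau y.
  have [T0|T0] := eqVneq T set0.
    by exists (rep y); [move=> i; rewrite T0 inE|apply: ty_rep].
  suff /asboolP : near T (rep x) (tau y) by [].
  rewrite -fits_rep //; under eq_bigr => i iT.
    rewrite (_ : wgt x (T, i, tau y) = wgt y (T, i, tau y)).
      over.
    by move: (iT); rewrite inE => /asboolP[_]; apply.
  rewrite fits_rep //; apply/asboolP; exists (rep y); last exact: ty_rep.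
  by move=> i _; apply: eqv_refl.
pose h z := if z == x then rep x else b.
have hx : h x = rep x by rewrite /h eqxx.
have hy : h y = b by rewrite /h (negPf xy).
have h_ty : ty_on [:: x; y] h.
  by move=> z; rewrite !inE => /orP[]/eqP->; rewrite ?hx ?hy ?ty_rep.
exists h; split=> //.
- move=> z z'; rewrite !inE => /orP[] /eqP-> /orP[] /eqP-> i;
    rewrite ?hx ?hy => zz'; try exact: eqv_refl.
    by apply: xb; rewrite inE; apply/asboolP.
  by apply/eqv_sym/xb; rewrite inE; apply/asboolP/dom_eqv_sym.
- move=> R xs t RP tX; apply: (base_hom RP h_ty) => // oi _ e.
    by case: nxy; exists oi.
  by case: nyx; exists oi.
Qed.

(** Negation exchanges the two directions, hence the joint induction. Below a quantifier or negation
    [h] may be replaced by another map: with two variables at most one stays free, and its 1-type is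
    all that matters. *)
Lemma transfer psi : unfo psi ->
  (forall chi, List.In chi (subformulas psi) -> occurs chi) ->
  {subset vars psi <= [:: p; q]} ->
  (forall (v : nat -> dom) h, hom [seq v z | z <- free_vars psi] h ->
    holds dom_struct v psi -> holds M (h \o v) psi) /\
  (forall (v : nat -> dom) h, back [seq v z | z <- free_vars psi] h ->
    holds M (h \o v) psi -> holds dom_struct v psi).
Proof.
elim: psi => [R xs|E x y|x y|psi1 IH1 psi2 IH2|psi1 IH1 psi2 IH2
  |z psi IH|psi IH] /=.
- move=> _ occ _; have RP : occurs (@Base _ R xs) by apply: occ; left.
  have e (v : nat -> dom) h :
      map_tuple (h \o v) xs = map_tuple h (map_tuple v xs).
    by apply: val_inj => /=; rewrite map_comp.
  split=> v h; last by case=> _ _ _ hR; rewrite e; apply: hR.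
  by case=> _ _ hR; rewrite e; apply: (hR _ xs).
- move=> _ occ _; have /(@In_tnth (formula sigma))[i si] : occurs (Dist E x y).
    by apply: occ; left.
  have xX (v : nat -> dom) : v x \in [:: v x; v y] by rewrite !inE eqxx.
  have yX (v : nat -> dom) : v y \in [:: v x; v y] by rewrite !inE eqxx orbT.
  split=> v h.
    case=> _ hE _ xy; have si' : exists z z', sub i = Dist E z z' by exists x, y.
    exact: (hE _ _ (xX v) (yX v) i (xy i si')) si.
  case=> _ _ hE _ xy j [z [z' sj]]; apply: hE => // F u u'.
  by rewrite /sub in sj *; rewrite sj => -[<- _ _].
- move=> _ _ _; split=> v h; first by move=> _ /= ->.
  by case=> _ inj _ _; apply: inj; rewrite !inE eqxx ?orbT.
- move=> /andP[u1 u2] occ var.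
  have [chi cP|z zP|hom1 back1] := IH1 u1.
  + by apply: occ; right; apply: List.in_or_app; left.
  + by apply: var; rewrite mem_cat zP.
  have [chi cP|z zP|hom2 back2] := IH2 u2.
  + by apply: occ; right; apply: List.in_or_app; right.
  + by apply: var; rewrite mem_cat zP orbT.
  split=> v h; rewrite map_cat => hX [h1 h2]; split.
  + apply: hom1 h1; apply: hom_sub hX => z zP; by rewrite mem_cat zP.
  + apply: hom2 h2; apply: hom_sub hX => z zP; by rewrite mem_cat zP orbT.
  + apply: back1 h1; apply: back_sub hX => z zP; by rewrite mem_cat zP.
  + apply: back2 h2; apply: back_sub hX => z zP; by rewrite mem_cat zP orbT.
- move=> /andP[u1 u2] occ var.
  have [chi cP|z zP|hom1 back1] := IH1 u1.
  + by apply: occ; right; apply: List.in_or_app; left.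
  + by apply: var; rewrite mem_cat zP.
  have [chi cP|z zP|hom2 back2] := IH2 u2.
  + by apply: occ; right; apply: List.in_or_app; right.
  + by apply: var; rewrite mem_cat zP orbT.
  split=> v h; rewrite map_cat => hX [h1|h1].
  + left; apply: hom1 h1; apply: hom_sub hX => z zP; by rewrite mem_cat zP.
  + right; apply: hom2 h1; apply: hom_sub hX => z zP; by rewrite mem_cat zP orbT.
  + left; apply: back1 h1; apply: back_sub hX => z zP; by rewrite mem_cat zP.
  + right; apply: back2 h1; apply: back_sub hX => z zP; by rewrite mem_cat zP orbT.
- move=> u occ var; have psiP : occurs (Exists z psi) by apply: occ; left.
  have {IH}[x xP|homI backI] := IH u (fun chi cP => occ chi (or_intror cP)).
    by apply: var; rewrite inE xP orbT.
  have fv_pq : {subset free_vars psi <= [:: p; q]}.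
    by move=> x /free_vars_sub xP; apply: var; rewrite inE xP orbT.
  have [o fv_o] : exists o, {in free_vars (Exists z psi), forall x, x = o}.
    have := var z (mem_head _ _); rewrite !inE => /orP[]/eqP ->; [exists q|exists p];
      by move=> x; rewrite mem_filter => /andP[/negPf xz /fv_pq]; rewrite !inE xz
        ?orbF => /eqP.
  split=> v h [h_ty _ _].
    move=> [d hd]; have [h' hom'] := hom_ex ([eta v with z |-> d] p)
      ([eta v with z |-> d] q).
    have [h'_ty _ _] := hom'.
    have sub_pq : {subset [seq [eta v with z |-> d] x | x <- free_vars psi] <=
        [:: [eta v with z |-> d] p; [eta v with z |-> d] q]}.
      by move=> _ /mapP[x /fv_pq + ->]; rewrite !inE => /orP[]/eqP ->;
        rewrite eqxx ?orbT.
    have {}hd := homI _ _ (hom_sub sub_pq hom') hd.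
    apply: (@occurs_ty_unary (Exists z psi) o (h' \o v) (h \o v)) => //.
      move=> x xP; rewrite /= h_ty ?map_f // -h'_ty //; apply: sub_pq.
      move: xP; rewrite mem_filter => /andP[/negPf xz xP].
      by apply/mapP; exists x; rewrite //= xz.
    exists (h' d); apply: holds_ext hd => x _ /=.
    by case: eqP.
  move=> _ hex.
  have {hex} : holds M (fun=> rep (v o)) (Exists z psi).
    apply: (@occurs_ty_unary (Exists z psi) o (h \o v)) hex => // x xP.
    by rewrite /= h_ty ?map_f // (fv_o x xP) ty_rep.
  have [i si] := In_tnth psiP => /(witP si) hb.
  exists (step (v o) (Some i)).
  have ext x : x \in free_vars psi -> x != z -> v x = v o.
    by move=> xP xz; rewrite (fv_o x) // mem_filter xz.
  apply: (backI _ (lift (v o) (Some i))).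
    apply: back_sub (@back_lift (v o) (Some i)) => _ /mapP[x xP ->] /=.
    by case: eqVneq => [_|xz]; rewrite !inE ?eqxx ?orbT // (ext x) ?eqxx.
  apply: holds_ext hb => x xP /=.
  by case: eqVneq => [_|xz]; rewrite ?lift_step // (ext x) // lift_src.
- move=> /andP[u /size_undup_le1[o fv_o]] occ var.
  have occ' chi cP := occ chi (or_intror cP).
  have psiP := occ' psi (subformulas_refl psi).
  have {IH}[homI backI] := IH u occ' var.
  have sub_o (v : nat -> dom) :
      {subset [seq v x | x <- free_vars psi] <= [:: v o; step (v o) None]}.
    by move=> _ /mapP[x /fv_o -> ->]; rewrite inE eqxx.
  split=> v h [h_ty _ _] => [|_] nh hh; apply: nh.
    apply: (backI v (lift (v o) None)).
      exact: back_sub (sub_o v) (@back_lift (v o) None).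
    apply: (@occurs_ty_unary psi o (h \o v)) hh => // x xP.
    by rewrite /= h_ty ?map_f // (fv_o x xP) lift_src ty_rep.
  have {}hh := homI v _ (hom_sub (sub_o v) (@hom_lift (v o) None)) hh.
  apply: (@occurs_ty_unary psi o _ (h \o v)) hh => // x xP.
  by rewrite /= h_ty ?map_f // (fv_o x xP) lift_src ty_rep.
Qed.

Lemma dom_inhabited (a : A) : inhabited dom.
Proof.
pose w : weights := retune [ffun=> false] set0 a.
have xP : `[< exists b, realizes (ty a, w, [ffun=> false], None, ord0) b >].
  apply/asboolP; exists a; split=> //; apply: fits_retune => T T0.
  by rewrite subset0 (negPf T0).
exact: (inhabits (exist (fun x : pre => `[< exists b, realizes x b >]) _ xP)).
Qed.

Lemma dom_model : unfo phi -> free_vars phi = [::] ->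
  (exists v, holds M v phi) -> is_model dom_struct phi.
Proof.
move=> u fv [v hv]; split; first exact: dom_admissible.
have [x] := dom_inhabited (v 0); exists (fun=> x).
have [_] := transfer u (fun _ => id) vars_phi.
move/(_ (fun=> x) (fun=> v 0)); apply.
  rewrite fv /=; split=> // R t tX Rt; exists x, None; split=> [y /tX //|].
  suff -> : map_tuple (lift x None) t = map_tuple (fun=> v 0) t by [].
  by apply: eq_from_tnth => i; have := tX _ (mem_tnth i t).
by apply: holds_ext hv => z; rewrite fv.
Qed.

Lemma card_dom : #|dom| <= 2 ^ (2 ^ (4 * length phi)).
Proof.
rewrite card_sig; apply: leq_trans (max_card _) _.
rewrite !card_prod card_option !card_ffun !card_prod !card_ffun.
have -> : #|{: {set 'I_n}}| = 2 ^ n.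
  by rewrite -cardsT -powersetT card_powerset cardsT card_ord.
rewrite !card_bool !card_ord.
have n0 : 0 < n by rewrite /n; case: (phi).
have nL : n <= length phi := size_subformulas phi.
have n2 : n.+1 <= 2 ^ n := ltn_expl n (leqnn 2).
apply: (@leq_trans (2 ^ (n + 2 ^ n * n * 2 ^ n + n + n + 2))).
  by rewrite !expnD !leq_mul.
rewrite leq_exp2l //; apply: (@leq_trans (2 ^ (4 * n))); last first.
  by rewrite leq_exp2l // leq_mul2l.
rewrite (mulnC 4 n) expnM !expnS expn0 muln1.
have a2 : 2 <= 2 ^ n by rewrite -{1}(expn1 2) leq_exp2l.
move: (2 ^ n) n2 a2 => a na a2.
have ana : a * n * a + a * a <= a * (a * a) by nia.
have aaa : 2 * (a * (a * a)) <= a * (a * (a * a)) by rewrite leq_mul2r a2 orbT.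
have aa : 2 * (a * a) <= a * (a * a) by rewrite leq_mul2r a2 orbT.
have a2a : 2 * a <= a * a by rewrite leq_mul2r a2 orbT.
lia.
Qed.

End FiniteModel.

Theorem theorem2 :
  exists c d : nat,
    forall (sigma : signature) (phi : formula sigma),
      unfo2 phi -> satisfiable phi ->
      exists (D : finType) (M : structure sigma D),
        is_model M phi /\ #|D| <= 2 ^ (2 ^ (c * length phi ^ d)).
Proof.
exists 20, 1 => sigma phi /andP[u /size_undup_le2[p [q vars_pq]]].
move=> [A [M [admM [v hv]]]].
pose psi := Exists p (Exists q phi).
have psi_vars : {subset vars psi <= [:: p; q]}.
  move=> z; rewrite !inE => /or3P[->|->|/vars_pq] //; first by rewrite orbT.
  by rewrite !inE.
have psi_fv : free_vars psi = [::].
  apply/eqP; rewrite -size_eq0 size_filter -leqn0 leqNgt -has_count.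
  apply/hasPn => z; rewrite mem_filter => /andP[zq /free_vars_sub/vars_pq].
  by rewrite !inE (negPf zq) orbF negbK.
have hpsi : exists v', holds M v' psi.
  exists v, (v p), (v q); apply: holds_ext hv => z _ /=.
  by do 2!case: eqP => [->|_] //.
have [admD [w [d [e hde]]]] := dom_model admM psi_vars u psi_fv hpsi.
exists (dom M psi), (dom_struct M psi); split.
  by split=> //; exists [eta [eta w with p |-> d] with q |-> e].
apply: leq_trans (@card_dom _ _ M psi) _.
rewrite !leq_exp2l //= expn1.
have : 0 < length phi by case: (phi).
lia.
Qed.
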